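(* Let $\Phi$ be a continuous random dynamical system on $\mathbb X=X\times P$ over $\{\theta_t\}_{t\in\mathbb R}$, and let $\mathfrak D$ be the product universe induced by $\mathfrak D_X$ and $\mathfrak D_P$. Suppose that $\Phi$ has a $\mathfrak D$-pullback absorbing random closed set $K=\{K(\omega)\}_{\omega\in\Omega}\in\mathfrak D$ and that $\Phi$ is $\mathfrak D$-pullback asymptotically compact. Then $\Phi$ has a unique $\mathfrak D$-pullback random attractor $\mathcal A=\{\mathcal A(\omega)\}_{\omega\in\Omega}$, given by $$\mathcal A(\omega)=\bigcap_{\tau\ge0}\overline{\bigcup_{t\ge\tau}\Phi(t,\theta_{-t}\omega)K(\theta_{-t}\omega)}^{\,\mathbb X},\qquad \omega\in\Omega.$$ Moreover, $\mathcal A(\omega)\subset K(\omega)$ for every $\omega\in\Omega$.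
   Context: $(\Omega,\mathcal F,\mathbb P,\{\theta_t\}_{t\in\mathbb R})$ is a metric dynamical system; all pathwise statements are understood on a fixed measurable $\theta_t$-invariant set of full probability, again denoted $\Omega$. $X$ is a separable Banach space with norm $\|\cdot\|_X$; $\mathcal P_2(X)$ is the set of Borel probability measures on $X$ with finite second moment, with the 2-Wasserstein metric $\mathcal W_{2,X}$, $\mathcal W_{2,X}^2(\mu,\nu)=\inf_{\pi\in\Pi(\mu,\nu)}\int_{X\times X}\|x-y\|_X^2\,\pi(dx,dy)$, where $\Pi(\mu,\nu)$ is the set of couplings. $P$ is a complete separable metric subspace of $(\mathcal P_2(X),\mathcal W_{2,X})$, and $\mathbb X=X\times P$ carries the metric $d_{\mathbb X}((x,\mu),(y,\nu))=\|x-y\|_X+\mathcal W_{2,X}(\mu,\nu)$. A continuous random dynamical system on $\mathbb X$ over $\{\theta_t\}$ is a jointly measurable map $\Phi:\mathbb R^+\times\Omega\times\mathbb X\to\mathbb X$ ($\mathbb R^+=[0,\infty)$) with $\Phi(0,\omega)=\mathrm{id}_{\mathbb X}$, $\Phi(t+s,\omega)=\Phi(t,\theta_s\omega)\circ\Phi(s,\omega)$ for $s,t\ge0$, and $z\mapsto\Phi(t,\omega)z$ continuous for all $t\geq 0,\omega$. Universes: $\mathfrak D_X$ is an inclusion-closed collection of families $B_X=\{B_X(\omega)\}_{\omega\in\Omega}$ of nonempty subsets of $X$, and $\mathfrak D_P$ is an inclusion-closed collection of nonempty subsets of $P$ (inclusion closed: any (family of) nonempty subset(s) contained (for each $\omega$)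 in a member is a member). The induced product universe $\mathfrak D$ consists of all families $D=\{D(\omega)\}_{\omega\in\Omega}$ of nonempty subsets of $\mathbb X$ for which there are $B_X\in\mathfrak D_X$, $B_P\in\mathfrak D_P$ with $D(\omega)\subset B_X(\omega)\times B_P$ for all $\omega$. For nonempty $C_1,C_2\subset\mathbb X$: $d_{\mathbb X}(z,C)=\inf_{a\in C}d_{\mathbb X}(z,a)$, $\operatorname{dist}_{\mathbb X}(C_1,C_2)=\sup_{z\in C_1}d_{\mathbb X}(z,C_2)$. A family $K$ of nonempty closed subsets of $\mathbb X$ is a random closed set if $\omega\mapsto d_{\mathbb X}(z,K(\omega))$ is measurable for every $z\in\mathbb X$; a random compact set is a random closed set with compact values. $K$ is $\mathfrak D$-pullback absorbing if for every $D\in\mathfrak D$, $\omega\in\Omega$ there is $T_D(\omega)\ge0$ with $\Phi(t,\theta_{-t}\omega)D(\theta_{-t}\omega)\subset K(\omega)$ for $t\ge T_D(\omega)$. $\Phi$ is $\mathfrak D$-pullback asymptotically compact if whenever $D\in\mathfrak D$, $\omega\in\Omega$, $t_n\to\infty$, $z_n\in D(\theta_{-t_n}\omega)$, the sequence $\Phi(t_n,\theta_{-t_n}\omega)z_n$ has a convergent subsequence in $\mathbb X$. A random compact set $\mathcal A$ is a $\mathfrak D$-pullback random attractor if $\mathcal A\in\mathfrak D$, $\Phi(t,\omega)\mathcal A(\omega)=\mathcal A(\theta_t\omega)$ for all $t\ge0$, $\omega\in\Omega$, and $\lim_{t\to\infty}\operatorname{dist}_{\mathbb X}(\Phi(t,\theta_{-t}\omega)D(\theta_{-t}\omega),\mathcal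 A(\omega))=0$ for all $D\in\mathfrak D$, $\omega\in\Omega$. *)

(* Defs.v *)
From HB Require Import structures.
From mathcomp Require Import all_boot all_order all_algebra.
From mathcomp Require Import all_classical all_reals all_analysis.
From mathcomp Require Import measurable_realfun ring lra.

Set Implicit Arguments.
Unset Strict Implicit.
Unset Printing Implicit Defensive.

Import Order.TTheory GRing.Theory Num.Theory.
Import numFieldNormedType.Exports.

Local Open Scope classical_set_scope.
Local Open Scope ring_scope.

Definition separable (T : topologicalType) : Prop :=
  exists2 D : set T, countable D & dense D.

(* The axiom of the library's [completeType], without its structure. *)
Definition complete_uniform (T : uniformType) : Prop :=
  forall F : set_system T, ProperFilter F -> cauchy F -> exists x : T, F --> x.

HB.mixin Record isSeparable T & Topological T := {
  separable_subproof : separable T }.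

#[short(type="separableBanachType")]
HB.structure Definition SeparableBanach (R : realType) :=
  { T of CompleteNormedModule R T & isSeparable T }.

Notation borel T := (g_sigma_algebraType (@open T)).

Section wasserstein.
Context {R : realType} {X : separableBanachType R}.
Local Open Scope ereal_scope.

Definition second_moment (mu : probability (borel X) R) : \bar R :=
  \int[mu]_x ((`|x : X| ^+ 2)%R)%:E.

(* A library measure is a function on all subsets, so that two measures that
   agree on the Borel sets may differ elsewhere. [P2_measurable] selects one
   function per Borel measure: equality on [P2 X] is equality of measures. *)
Record P2 := MkP2 {
  P2_prob :> probability (borel X) R ;
  P2_measurable : forall A, ~ measurable A -> P2_prob A = 0 ;
  P2_second_moment : second_moment P2_prob < +oo }.

(* As X is separable, the product sigma-algebra is the Borel one on X * X. *)
Definition is_coupling (mu nu : probability (borel X) R)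
    (pi : probability (borel X * borel X)%type R) : Prop :=
  forall A, measurable A -> pi (A `*` setT) = mu A /\ pi (setT `*` A) = nu A.

Definition transport_cost (pi : probability (borel X * borel X)%type R) :
    \bar R :=
  \int[pi]_z ((`|(z.1 : X) - (z.2 : X)| ^+ 2)%R)%:E.

Definition W2 (mu nu : P2) : R :=
  Num.sqrt (fine (ereal_inf (transport_cost @` is_coupling mu nu))).

HB.instance Definition _ := gen_eqMixin P2.
HB.instance Definition _ := gen_choiceMixin P2.

Local Notation B := (borel X).

Lemma dense_sequence :
  exists e : nat -> X, forall x (r : R), (0 < r)%R -> exists n, (`|x - e n| < r)%R.
Proof.
have [D /pcard_surjP[e eD] dD] : separable X by exact: separable_subproof.
exists e => x r r0; have [y [xy Dy]] := dD (ball x r)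
  (ex_intro _ x (ballxx x r0)) (ball_open x r).
have [n _ eny] := eD _ Dy.
by exists n; rewrite eny; move: xy; rewrite -ball_normE.
Qed.

Lemma open_borel (U : set X) : open U -> measurable (U : set B).
Proof. exact: sub_sigma_algebra. Qed.

Lemma measurable_norm_subr (c : X) :
  measurable_fun setT (fun x : B => `|(x : X) - c|%R).
Proof.
move=> _; apply: (measurability _ (RGenInftyO.measurableE R)) => //.
move=> _ [_ [r ->] <-]; rewrite setTI; apply: open_borel.
rewrite (_ : _ @^-1` _ = ball c r); last first.
  by apply/seteqP; split => x /=; rewrite in_itv/= -ball_normE/= distrC.
have [r0|r0] := ltP 0%R r; first exact: ball_open.
rewrite (_ : ball c r = set0); first exact: open0.
apply/seteqP; split => // x; rewrite -ball_normE/= => cxr.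
by have := lt_le_trans cxr r0; rewrite ltNge normr_ge0.
Qed.

Lemma measurable_norm_borel : measurable_fun setT (fun x : B => `|x : X|%R).
Proof.
rewrite (_ : (fun x => _) = fun x : B => `|(x : X) - 0|%R).
  exact: measurable_norm_subr.
by apply/funext => x; rewrite subr0.
Qed.

Lemma measurable_norm_sub :
  measurable_fun setT (fun z : B * B => `|(z.1 : X) - (z.2 : X)|%R).
Proof.
have [e eP] := dense_sequence.
have mg n : measurable_fun setT
    (fun z : B * B => (`|(z.1 : X) - e n| + `|(z.2 : X) - e n|)%R).
  apply: measurable_funD.
    apply: (measurableT_comp (measurable_norm_subr (e n))).
    exact: measurable_fst.
  apply: (measurableT_comp (measurable_norm_subr (e n))).
  exact: measurable_snd.
move=> _; apply: (measurability _ (RGenInftyO.measurableE R)) => //.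
move=> _ [_ [r ->] <-]; rewrite setTI.
rewrite (_ : _ @^-1` _ = \bigcup_n
    ((fun z : B * B => (`|(z.1 : X) - e n| + `|(z.2 : X) - e n|)%R)
       @^-1` `]-oo, r[%classic)).
  by apply: bigcupT_measurable => n; rewrite -[X in measurable X]setTI; exact: mg.
apply/seteqP; split => [[x y]/=|[x y] [n _]/=]; rewrite !in_itv/=.
  move=> xyr; have [n] := eP x ((r - `|(x : X) - (y : X)|) / 2)%R
    ltac:(by rewrite divr_gt0// subr_gt0).
  move=> xn; exists n => //=; rewrite in_itv/=.
  have : (`|(y : X) - e n| <= `|(x : X) - (y : X)| + `|(x : X) - e n|)%R.
    by rewrite (distrC (x : X) (y : X)) -(subrKA (x : X)) ler_normD.
  lra.
move=> xynr; apply: le_lt_trans xynr.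
by rewrite -(subrKA (e n)) (distrC (y : X)) ler_normD.
Qed.

Lemma measurable_cost :
  measurable_fun setT (fun z : B * B => ((`|(z.1 : X) - (z.2 : X)| ^+ 2)%R)%:E).
Proof.
by apply/measurable_EFinP; apply: measurable_funX; exact: measurable_norm_sub.
Qed.

Section L2.
Context d (T : measurableType d).
Implicit Types (m : {measure set T -> \bar R}) (f g : T -> R).

Definition L2 m f := 'N[m]_(2%:E)[EFin \o f].

Lemma L2_ge0 m f : 0 <= L2 m f. Proof. exact: Lnorm_ge0. Qed.

Lemma L2E m f : L2 m f = (\int[m]_x ((f x ^+ 2)%R)%:E) `^ 2^-1.
Proof.
rewrite /L2 unlock; congr (_ `^ _); apply: eq_integral => x _ /=.
by rewrite powR_mulrn// real_normK// num_real.
Qed.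

Lemma integral_sqr_ge0 m f : 0 <= \int[m]_x ((f x ^+ 2)%R)%:E.
Proof. by apply: integral_ge0 => x _; rewrite lee_fin sqr_ge0. Qed.

Lemma measurable_sqrE f : measurable_fun setT f ->
  measurable_fun setT (fun x => ((f x ^+ 2)%R)%:E).
Proof. by move=> mf; apply/measurable_EFinP; exact: measurable_funX. Qed.

Lemma L2_le m f g : measurable_fun setT f -> measurable_fun setT g ->
  (forall x, (0 <= f x)%R) -> {ae m, forall x, (f x <= g x)%R} ->
  L2 m f <= L2 m g.
Proof.
move=> mf mg f0 fg; rewrite !L2E; apply: gt0_ler_poweR.
- by rewrite invr_ge0.
- by rewrite in_itv/= integral_sqr_ge0 leey.
- by rewrite in_itv/= integral_sqr_ge0 leey.
apply: ae_ge0_le_integral => //.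
- by move=> x _; rewrite lee_fin sqr_ge0.
- exact: measurable_sqrE.
- by move=> x _; rewrite lee_fin sqr_ge0.
- exact: measurable_sqrE.
- apply: filterS fg => x fgx _.
  by rewrite lee_fin ler_pXn2r// nnegrE// (le_trans (f0 x)).
Qed.

Lemma L2_triangle m f g : measurable_fun setT f -> measurable_fun setT g ->
  L2 m (f \+ g)%R <= L2 m f + L2 m g.
Proof. by move=> mf mg; apply: minkowski_EFin => //; rewrite ler1n. Qed.

End L2.

Lemma L2_map d (T : measurableType d) d' (T' : measurableType d')
    (m : {measure set T -> \bar R}) (m' : {measure set T' -> \bar R})
    (h : T -> T') (g : T' -> R) :
  measurable_fun setT h -> measurable_fun setT g ->
  (forall A, measurable A -> m (h @^-1` A) = m' A) ->
  L2 m (g \o h) = L2 m' g.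
Proof.
move=> mh mg mm'; rewrite !L2E; congr (_ `^ _).
rewrite [RHS](eq_measure_integral (pushforward m h)); last first.
  by move=> A mA _; rewrite -mm'.
rewrite [RHS]ge0_integral_pushforward//.
- exact: measurable_sqrE.
- by move=> y _; rewrite lee_fin sqr_ge0.
Qed.

Section mkprobability.
Context d (T : measurableType d) (m : {measure set T -> \bar R}).
Definition mkprobability (_ : m setT = 1) : set T -> \bar R := m.
Hypothesis m1 : m setT = 1.
HB.instance Definition _ := Measure.on (mkprobability m1).
HB.instance Definition _ :=
  Measure_isProbability.Build _ _ _ (mkprobability m1) m1.
End mkprobability.

Let dist (z : B * B) : R := `|(z.1 : X) - (z.2 : X)|%R.
Let norm (x : B) : R := `|x : X|%R.

Lemma L2_dist (pi : probability (B * B)%type R) :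
  L2 pi dist = sqrte (transport_cost pi).
Proof. by rewrite L2E poweR12_sqrt// integral_sqr_ge0. Qed.

Lemma L2_fst mu nu pi (g : B -> R) : is_coupling mu nu pi ->
  measurable_fun setT g -> L2 pi (g \o fst) = L2 mu g.
Proof.
move=> cpi mg; apply: L2_map => // A mA.
by rewrite -setXT; exact: (cpi A mA).1.
Qed.

Lemma L2_snd mu nu pi (g : B -> R) : is_coupling mu nu pi ->
  measurable_fun setT g -> L2 pi (g \o snd) = L2 nu g.
Proof.
move=> cpi mg; apply: L2_map => // A mA.
by rewrite -setTX; exact: (cpi A mA).2.
Qed.

Lemma L2_norm_lty (mu : P2) : L2 mu norm < +oo.
Proof. by rewrite L2E poweR_lty// P2_second_moment. Qed.

Lemma L2_coupling_lty (mu nu : P2) pi : is_coupling mu nu pi ->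
  L2 pi dist < +oo.
Proof.
move=> cpi; have mN : measurable_fun setT norm := measurable_norm_borel.
have m1 : measurable_fun setT (norm \o @fst B B) by exact: measurableT_comp.
have m2 : measurable_fun setT (norm \o @snd B B) by exact: measurableT_comp.
apply: (@le_lt_trans _ _ (L2 pi ((norm \o @fst B B) \+ (norm \o @snd B B))%R)).
  apply: L2_le => //.
  - exact: measurable_norm_sub.
  - exact: measurable_funD.
  - by move=> z; exact: normr_ge0.
  - by apply: aeW => z /=; exact: ler_normB.
apply: le_lt_trans (L2_triangle _ m1 m2) _.
by rewrite (L2_fst cpi)// (L2_snd cpi)// lte_add_pinfty// L2_norm_lty.
Qed.

Lemma coupling_ex (mu nu : P2) : exists pi, is_coupling mu nu pi.
Proof.
exists (mu \x nu) => A mA; split.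
  apply: etrans (product_measure1E mu nu mA measurableT) _.
  by rewrite -[RHS]mule1; congr (_ * _); exact: probability_setT.
apply: etrans (product_measure1E mu nu measurableT mA) _.
by rewrite -[RHS]mul1e; congr (_ * _); exact: probability_setT.
Qed.

Let W2sq (mu nu : P2) := ereal_inf (transport_cost @` is_coupling mu nu).

Let W2sq_ge0 mu nu : 0 <= W2sq mu nu.
Proof. by apply: le_ereal_inf_tmp => _ [pi _ <-]; exact: integral_sqr_ge0. Qed.

Let cost_fin (mu nu : P2) pi : is_coupling mu nu pi ->
  transport_cost pi \is a fin_num.
Proof.
move=> /L2_coupling_lty; rewrite L2_dist => clty.
by rewrite -sqrte_fin_num ?integral_sqr_ge0// ge0_fin_numE ?sqrte_ge0.
Qed.

Let W2sq_fin mu nu : W2sq mu nu \is a fin_num.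
Proof.
have [pi cpi] := coupling_ex mu nu.
rewrite ge0_fin_numE//; apply: (@le_lt_trans _ _ (transport_cost pi)).
  by apply: ereal_inf_lbound; exists pi.
by rewrite ltey_eq (cost_fin cpi).
Qed.

Let W2E mu nu : (W2 mu nu)%:E = sqrte (W2sq mu nu).
Proof. by rewrite /W2 -/(W2sq mu nu); case: (W2sq mu nu) (W2sq_fin mu nu). Qed.

Lemma W2_le (mu nu : P2) pi : is_coupling mu nu pi -> (W2 mu nu)%:E <= L2 pi dist.
Proof.
move=> cpi; rewrite L2_dist W2E lee_sqrt ?integral_sqr_ge0//.
by apply: ereal_inf_lbound; exists pi.
Qed.

Lemma W2_adherent (mu nu : P2) (e : R) : (0 < e)%R ->
  exists2 pi, is_coupling mu nu pi & L2 pi dist <= (W2 mu nu + e)%:E.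
Proof.
move=> e0; have e20 : (0 < e ^+ 2)%R by rewrite exprn_gt0.
have [_ [pi cpi <-] lepi] := lb_ereal_inf_adherent e20 (W2sq_fin mu nu).
exists pi => //; rewrite L2_dist.
have W0 : (0 <= W2 mu nu)%R by exact: sqrtr_ge0.
have -> : (W2 mu nu + e)%:E = sqrte (((W2 mu nu + e) ^+ 2)%R)%:E.
  by rewrite /= sqrtr_sqr ger0_norm// addr_ge0// ltW.
rewrite lee_sqrt ?lee_fin ?sqr_ge0//; apply: le_trans (ltW lepi) _.
rewrite -/(W2sq mu nu) -(sqr_sqrte (W2sq_ge0 mu nu)) -W2E -EFin_expe -EFinD.
have We0 : (0 <= W2 mu nu * e)%R by rewrite mulr_ge0// ltW.
by rewrite lee_fin; lra.
Qed.

Lemma pushforward_probability d d' (T : measurableType d)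
    (T' : measurableType d') (m : {measure set T -> \bar R}) (h : T -> T') :
  m setT = 1 -> measurable_fun setT h ->
  exists q : probability T' R, forall A, q A = m (h @^-1` A).
Proof.
move=> m1 mh; pose h' : {mfun T >-> T'} := HB.pack h (isMeasurableFun.Build _ _ _ _ _ mh).
by exists (distribution (mkprobability m1) h').
Qed.

Lemma W2_ge0 (mu nu : P2) : (0 <= W2 mu nu)%R.
Proof. exact: sqrtr_ge0. Qed.

Lemma W2xx (mu : P2) : W2 mu mu = 0%R.
Proof.
apply/eqP; rewrite eq_le W2_ge0 andbT.
have mh : measurable_fun setT (fun x : B => (x, x)).
  by apply: measurable_fun_pair; exact: measurable_id.
have [pi piE] := pushforward_probability (probability_setT mu) mh.
have cpi : is_coupling mu mu pi.
  move=> A mA; rewrite !piE; split; congr (mu _).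
    by apply/seteqP; split => x /=; [case|].
  by apply/seteqP; split => x /=; [case|].
rewrite -lee_fin (le_trans (W2_le cpi))//.
rewrite -(L2_map mh measurable_norm_sub (m := mu)); last by move=> A mA; exact/esym/piE.
rewrite L2E (eq_integral (cst 0)); last first.
  by move=> x _ /=; rewrite subrr normr0 expr0n.
by rewrite integral0 poweR0r// invr_eq0.
Qed.

Lemma W2_swap (mu nu : P2) : (W2 mu nu <= W2 nu mu)%R.
Proof.
apply/ler_addgt0Pr => e e0; have [pi cpi lepi] := W2_adherent nu mu e0.
have mh : measurable_fun setT (fun z : B * B => (z.2, z.1)).
  by apply: measurable_fun_pair; [exact: measurable_snd|exact: measurable_fst].
have [pi' piE] := pushforward_probability (probability_setT pi) mh.
have cpi' : is_coupling mu nu pi'.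
  move=> A mA; rewrite !piE -(cpi A mA).1 -(cpi A mA).2; split; congr (pi _).
    by apply/seteqP; split => -[x y] /= [].
  by apply/seteqP; split => -[x y] /= [].
rewrite -lee_fin (le_trans (W2_le cpi'))//; apply: le_trans lepi.
rewrite -(L2_map mh measurable_norm_sub (m := pi)); last by move=> A mA; exact/esym/piE.
apply: L2_le.
- apply: measurableT_comp mh; exact: measurable_norm_sub.
- exact: measurable_norm_sub.
- by move=> z; exact: normr_ge0.
- by apply: aeW => z /=; rewrite /dist/= distrC.
Qed.

Lemma W2_sym (mu nu : P2) : W2 mu nu = W2 nu mu.
Proof. by apply/eqP; rewrite eq_le !W2_swap. Qed.

Lemma probability_ext d (T : measurableType d) (m1 m2 : probability T R) :
  (m1 : set T -> \bar R) = m2 -> m1 = m2.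
Proof.
case: m1 m2 => s [[p q] [r] [t] [u] [v] [w] [x]].
case=> s' [[p' q'] [r'] [t'] [u'] [v'] [w'] [x']] /= ss'; subst s'.
by rewrite (Prop_irrelevance p' p) (Prop_irrelevance q' q)
  (Prop_irrelevance r' r) (Prop_irrelevance t' t) (Prop_irrelevance u' u)
  (Prop_irrelevance v' v) (Prop_irrelevance w' w) (Prop_irrelevance x' x).
Qed.

Lemma P2_ext (mu nu : P2) : (forall A, measurable A -> mu A = nu A) -> mu = nu.
Proof.
case: mu nu => mu mu0 mu2 [nu nu0 nu2] /= mn.
have mnE : mu = nu.
  apply: probability_ext; apply/funext => A.
  by have [mA|mA] := pselect (measurable A); [exact: mn|rewrite mu0// nu0].
subst nu.
by rewrite (Prop_irrelevance nu0 mu0) (Prop_irrelevance nu2 mu2).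
Qed.

Lemma measurable_tail (a : R) : measurable [set z | (a <= dist z)%R].
Proof.
rewrite -[X in measurable X]setTI.
rewrite (_ : [set z | _] = dist @^-1` `[a, +oo[%classic); last first.
  by apply/seteqP; split => z /=; rewrite in_itv/= andbT.
exact: measurable_norm_sub.
Qed.

Lemma coupling_tail (mu nu : P2) pi (a e : R) : is_coupling mu nu pi ->
  (0 < a)%R -> (0 < e)%R -> L2 pi dist <= (a * Num.sqrt e)%:E ->
  pi [set z | (a <= dist z)%R] <= e%:E.
Proof.
move=> cpi a0 e0; rewrite L2_dist.
have -> : (a * Num.sqrt e)%:E = sqrte ((a ^+ 2 * e)%R)%:E.
  by rewrite /= sqrtrM ?sqr_ge0// sqrtr_sqr gtr0_norm.
rewrite lee_sqrt => [costle|]; last first.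
  by rewrite lee_fin mulr_ge0// ?sqr_ge0// ltW.
have mS := measurable_tail a.
rewrite -(@lee_pmul2l _ (a ^+ 2)%:E) ?lte_fin ?exprn_gt0//.
rewrite -EFinM; apply: le_trans costle.
rewrite -integral_cst// /transport_cost.
apply: (@le_trans _ _ (\int[pi]_(z in [set z | (a <= dist z)%R]) ((dist z ^+ 2)%R)%:E)).
  apply: ge0_le_integral => //.
  - by move=> z _; rewrite lee_fin sqr_ge0.
  - by apply: measurable_funTS; exact: measurable_cost.
  - by move=> z az; rewrite lee_fin ler_pXn2r// nnegrE ?(ltW a0)// normr_ge0.
apply: ge0_subset_integral => //; first exact: measurable_cost.
by move=> z _; rewrite lee_fin sqr_ge0.
Qed.

Lemma W2_eq0_le_closed (mu nu : P2) (F : set X) : W2 mu nu = 0%R -> closed F ->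
  mu F <= nu F.
Proof.
move=> W0 cF.
pose U n : set X := [set y | exists2 x, F x & ball x n.+1%:R^-1 y].
have oU n : open (U n).
  rewrite (_ : U n = \bigcup_(x in F) ball x n.+1%:R^-1).
    by apply: bigcup_open => x Fx; apply: ball_open; rewrite invr_gt0.
  by apply/seteqP; split => y [x Fx xy]; exists x.
have capU : \bigcap_n U n = F.
  apply/seteqP; split => [y Uy|y Fy n _]; last first.
    by exists y => //; apply: ballxx; rewrite invr_gt0.
  rewrite (closure_id F).1// => V /nbhs_ballP[e/= e0 yeV].
  have [n _ /(_ _ (leqnn n)) ne] := near_infty_natSinv_lt (PosNum e0).
  have [x Fx xy] := Uy n I.
  exists x; split => //; apply: yeV; apply: ball_sym.
  by apply: le_ball xy; exact: ltW.
have muU n : mu F <= nu (U n).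
  apply/lee_addgt0Pr => e e0.
  have a0 : (0 < n.+1%:R^-1 :> R)%R by rewrite invr_gt0.
  have ae0 : (0 < n.+1%:R^-1 * Num.sqrt e)%R by rewrite mulr_gt0// sqrtr_gt0.
  have [pi cpi] := W2_adherent mu nu ae0; rewrite W0 add0r => pile.
  have {}pile := coupling_tail cpi a0 e0 pile.
  have mF : measurable (F : set B).
    by rewrite -(setCK F); apply: measurableC; apply: open_borel; exact: closed_openC.
  have mU : measurable (U n : set B) by exact: open_borel.
  rewrite -(cpi _ mF).1 -(cpi _ mU).2.
  have mS := measurable_tail n.+1%:R^-1.
  have mTU : measurable (setT `*` U n : set (B * B)) by exact: measurableX.
  have mFT : measurable (F `*` setT : set (B * B)) by exact: measurableX.
  apply: le_trans (leeD2l _ pile); apply: le_trans (measureU2 _ _ _) => //.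
  apply: le_measure; rewrite ?inE//; first exact: measurableU.
  move=> [x y] /= [Fx _]; have [xy|xy] := leP n.+1%:R^-1%R (dist (x, y)).
    by right.
  by left; split => //; exists x => //; rewrite -ball_normE.
rewrite -[in leRHS]capU.
suff /cvge_to_ge : (nu \o U) n @[n --> \oo] --> nu (\bigcap_n U n).
  by apply; apply: nearW => n /=; exact: muU.
apply: nonincreasing_cvg_mu.
- by rewrite -ge0_fin_numE// fin_num_measure//; exact: open_borel.
- by move=> n; exact: open_borel.
- by apply: bigcapT_measurable => n; exact: open_borel.
- move=> m n mn; apply/subsetPset => y [x Fx xy]; exists x => //.
  by apply: le_ball xy; rewrite lef_pV2 ?posrE// ler_nat.
Qed.

Lemma W2_eq0 (mu nu : P2) : W2 mu nu = 0%R -> mu = nu.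
Proof.
move=> W0; apply: P2_ext => A mA.
have Ec (F : set X) : closed F -> mu F = nu F.
  move=> cF; apply/eqP; rewrite eq_le !W2_eq0_le_closed//.
  by rewrite W2_sym.
have Eo (U : set X) : open U -> mu U = nu U.
  move=> oU; have mUC : measurable (~` U : set B).
    by apply: measurableC; exact: open_borel.
  rewrite -(setCK U) (probability_setC mu mUC) (probability_setC nu mUC) Ec//.
  exact: open_closedC.
apply: (@g_sigma_algebra_measure_unique _ _ B (@open X) _ (fun=> setT)) => //.
- exact: open_borel.
- by move=> _; exact: openT.
- by rewrite bigcup_const//; exists 0%N.
- by move=> U V; exact: openI.
- by move=> _; apply: (@le_lt_trans _ _ 1); [exact: probability_le1|exact: ltry].
Qed.

Lemma measurable_gap (e : R) : measurable
  [set z : (B * B) * (B * B) | (e <= dist (z.1.2, z.2.1))%R].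
Proof.
have mh : measurable_fun setT (fun z : (B * B) * (B * B) => (z.1.2, z.2.1)).
  apply: measurable_fun_pair.
    exact: measurableT_comp measurable_snd measurable_fst.
  exact: measurableT_comp measurable_fst measurable_snd.
rewrite -[X in measurable X]setTI.
by have := mh measurableT _ (measurable_tail e).
Qed.

(* Gluing without disintegration: cut the space of the middle marginal into
   countably many pieces of diameter less than e and couple p12 and p23
   independently over each piece. *)
Section gluing.
Variables (mu nu rho : P2) (p12 p23 : probability (B * B)%type R) (e : R).
Hypotheses (c12 : is_coupling mu nu p12) (c23 : is_coupling nu rho p23).
Hypothesis e0 : (0 < e)%R.

Lemma gluing_partition : exists A : (set B)^nat,
  [/\ forall i, measurable (A i), trivIset setT A, \bigcup_i A i = setT &
      forall i x y, A i x -> A i y -> (`|(x : X) - (y : X)| < e)%R].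
Proof.
have [s sP] := dense_sequence.
have e20 : (0 < e / 2)%R by rewrite divr_gt0.
pose U i : set B := ball (s i) (e / 2)%R.
exists (seqDU U); split.
- move=> i; apply: measurableD; first by apply: open_borel; exact: ball_open.
  by apply: bigsetU_measurable => j _; apply: open_borel; exact: ball_open.
- exact: trivIset_seqDU.
- rewrite -seqDU_bigcup_eq; apply/seteqP; split => // x _.
  have [n xn] := sP x _ e20; exists n => //.
  by rewrite /U -ball_normE/= distrC.
- move=> i x y ix iy; move: (subset_seqDU ix) (subset_seqDU iy).
  rewrite /U -ball_normE/= => {}ix {}iy.
  have := ler_normD ((x : X) - s i)%R (s i - (y : X))%R.
  rewrite addrA subrK (distrC (x : X) (s i)) => /le_lt_trans; apply.
  by rewrite (splitr e) ltrD.
Qed.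

Lemma gluing : exists g : probability ((B * B) * (B * B))%type R,
  [/\ forall A, measurable A -> g (A `*` setT) = p12 A,
      forall A, measurable A -> g (setT `*` A) = p23 A &
      g [set z | (e <= dist (z.1.2, z.2.1))%R] = 0].
Proof.
have [A [mA tA UA dA]] := gluing_partition.
have mD1 i : measurable (setT `*` A i : set (B * B)) by exact: measurableX.
have mD2 i : measurable (A i `*` setT : set (B * B)) by exact: measurableX.
have nuA0 i : (0 <= (fine (nu (A i)))^-1)%R by rewrite invr_ge0 fine_ge0.
pose m i := mscale (NngNum (nuA0 i)) (mrestr p12 (mD1 i) \x mrestr p23 (mD2 i)).
pose g := mseries m 0.
have scaleK i (x : \bar R) : 0 <= x -> x <= nu (A i) ->
    (fine (nu (A i)))^-1%:E * (x * nu (A i)) = x.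
  move=> x0; have [->|nA] := eqVneq (nu (A i)) 0.
    by move=> x0'; rewrite mule0 mule0; apply/eqP; rewrite eq_le x0 x0'.
  move=> xn; have nf : nu (A i) \is a fin_num by exact: fin_num_measure.
  by rewrite muleCA -{2}(fineK nf) -EFinM mulVf ?mule1// fine_eq0.
have mE i C D : measurable C -> measurable D -> m i (C `*` D) =
    (fine (nu (A i)))^-1%:E * (p12 (C `&` (setT `*` A i)) * p23 (D `&` (A i `*` setT))).
  by move=> mC mD; rewrite /m /mscale/= product_measure1E.
have g1 C : measurable C -> g (C `*` setT) = p12 C.
  move=> mC; rewrite /g /mseries.
  transitivity (\sum_(i <oo) p12 (C `&` (setT `*` A i))).
    apply: eq_eseriesr => i _; apply: etrans (mE i _ _ mC measurableT) _.
    rewrite setTI (c23 (mA i)).1 scaleK//.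
    rewrite -(c12 (mA i)).2; apply: le_measure; rewrite ?inE//.
    exact: measurableI.
  rewrite -measure_semi_bigcup.
  - by rewrite -setI_bigcupr -setX_bigcupr UA setXTT setIT.
  - by move=> i; exact: measurableI.
  - apply/trivIsetP => i j _ _ ij; rewrite setIACA -setXI.
    by move/trivIsetP : tA => ->//; rewrite setX0 setI0.
  - by apply: bigcupT_measurable => i; exact: measurableI.
have g2 C : measurable C -> g (setT `*` C) = p23 C.
  move=> mC; rewrite /g /mseries.
  transitivity (\sum_(i <oo) p23 (C `&` (A i `*` setT))).
    apply: eq_eseriesr => i _; apply: etrans (mE i _ _ measurableT mC) _.
    rewrite setTI (c12 (mA i)).2.
    rewrite [X in _ * X]muleC scaleK//.
    rewrite -(c23 (mA i)).1; apply: le_measure; rewrite ?inE//.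
    exact: measurableI.
  rewrite -measure_semi_bigcup.
  - by rewrite -setI_bigcupr -setX_bigcupl UA setXTT setIT.
  - by move=> i; exact: measurableI.
  - apply/trivIsetP => i j _ _ ij; rewrite setIACA -setXI.
    by move/trivIsetP : tA => ->//; rewrite set0X setI0.
  - by apply: bigcupT_measurable => i; exact: measurableI.
have gT : g setT = 1 by rewrite -setXTT g1// probability_setT.
exists (mkprobability gT); split => //.
set S := [set z | _].
have mS : measurable S by exact: measurable_gap.
apply: eseries0 => i _ _.
have mC1 : measurable (~` (setT `*` A i) : set (B * B)) by exact: measurableC.
have mC2 : measurable (~` (A i `*` setT) : set (B * B)) by exact: measurableC.
apply: (@subset_measure0 _ _ _ (m i) S
    (~` (setT `*` A i) `*` setT `|` setT `*` ~` (A i `*` setT))) => //.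
- by apply: measurableU; exact: measurableX.
- move=> [[x y] [y' z]] /= exy.
  have [Ay|nAy] := pselect (A i y); last by left; split => // -[].
  right; split => // -[Ay' _].
  by have := dA i y y' Ay Ay'; rewrite ltNge exy.
- apply/eqP; rewrite -measure_le0.
  apply: le_trans (measureU2 _ _ _) _; try exact: measurableX.
  rewrite [X in X + _](_ : _ = 0); last first.
    by apply: etrans (mE i _ _ mC1 measurableT) _; rewrite setICl measure0 mul0e mule0.
  rewrite [X in _ + X](_ : _ = 0) ?adde0//.
  by apply: etrans (mE i _ _ measurableT mC2) _; rewrite setICl measure0 !mule0.
Qed.
End gluing.

Lemma W2_triangle (nu mu rho : P2) : (W2 mu rho <= W2 mu nu + W2 nu rho)%R.
Proof.
apply/ler_addgt0Pr => e e0; pose e3 := (e / 3)%R.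
have e30 : (0 < e3)%R by rewrite divr_gt0.
have [p12 c12 le12] := W2_adherent mu nu e30.
have [p23 c23 le23] := W2_adherent nu rho e30.
have [g [g1 g2 g0]] := gluing c12 c23 e30.
have mx : measurable_fun setT (fun z : (B * B) * (B * B) => (z.1.1, z.2.2)).
  apply: measurable_fun_pair.
    exact: measurableT_comp measurable_fst measurable_fst.
  exact: measurableT_comp measurable_snd measurable_snd.
have [q qE] := pushforward_probability (probability_setT g) mx.
have cq : is_coupling mu rho q.
  move=> A mA; rewrite !qE; split.
    rewrite -(c12 A mA).1 -g1; last exact: measurableX.
    by congr (g _); apply/seteqP; split => -[[x y] [y' z]] /=; tauto.
  rewrite -(c23 A mA).2 -g2; last exact: measurableX.
  by congr (g _); apply/seteqP; split => -[[x y] [y' z]] /=; tauto.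
have mdist := measurable_norm_sub.
have m1 : measurable_fun setT (dist \o @fst (B * B) (B * B)).
  exact: measurableT_comp.
have m2 : measurable_fun setT (dist \o @snd (B * B) (B * B)).
  exact: measurableT_comp.
have me : measurable_fun setT (cst e3 : (B * B) * (B * B) -> R) by [].
rewrite -lee_fin (le_trans (W2_le cq))//.
rewrite -(L2_map mx mdist (m := g)); last by move=> A mA; exact/esym/qE.
apply: (@le_trans _ _
    (L2 g ((dist \o @fst (B * B) (B * B)) \+ (dist \o @snd (B * B) (B * B))
           \+ cst e3)%R)).
  apply: L2_le.
  - exact: measurableT_comp mdist mx.
  - by apply: measurable_funD => //; exact: measurable_funD.
  - by move=> z; exact: normr_ge0.
  - exists [set z | (e3 <= dist (z.1.2, z.2.1))%R]; split => //.
      exact: measurable_gap.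
    move=> [[x y] [y' z]] /=; apply: contra_notP => /negP; rewrite -ltNge.
    rewrite /dist/= => yy'.
    have := ler_normD ((x : X) - (y : X))%R ((y : X) - (z : X))%R.
    have := ler_normD ((y : X) - (y' : X))%R ((y' : X) - (z : X))%R.
    by rewrite !subrKA; lra.
apply: le_trans (L2_triangle _ _ me) _; first exact: measurable_funD.
apply: le_trans (leeD2r _ (L2_triangle _ m1 m2)) _.
rewrite (L2_map (m' := p12) (h := fst) measurable_fst mdist)//; last first.
  by move=> A mA; rewrite -setXT; exact: g1.
rewrite (L2_map (m' := p23) (h := snd) measurable_snd mdist)//; last first.
  by move=> A mA; rewrite -setTX; exact: g2.
have -> : L2 g (cst e3) = e3%:E.
  rewrite L2E (eq_integral (cst ((e3 ^+ 2)%R)%:E))// integral_cst//.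
  rewrite [X in _ * X](_ : _ = 1) ?mule1; last exact: probability_setT.
  rewrite poweR12_sqrt ?lee_fin ?sqr_ge0//=.
  by rewrite sqrtr_sqr gtr0_norm.
apply: le_trans (leeD2r _ (leeD le12 le23)) _.
by rewrite -!EFinD lee_fin /e3; lra.
Qed.

HB.instance Definition _ := isMetric.Build R P2 W2xx W2_eq0 W2_sym W2_triangle.

Lemma mdist_P2 (mu nu : P2) : mdist mu nu = W2 mu nu.
Proof. by []. Qed.

End wasserstein.
Arguments P2 {R} X.

Section subset_metric.
Context {R : realType} {T : metricType R} (A : set T).
Implicit Types x y : set_type A.

Let dist x y : R := mdist (\val x) (\val y).

Let dist_ge0 x y : 0 <= dist x y. Proof. exact: mdist_ge0. Qed.

Let dist_positivity x y : dist x y = 0 -> x = y.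
Proof. by move=> /mdist_positivity/val_inj. Qed.

Let ballEdist x d : ball x d = [set y | dist x y < d].
Proof.
rewrite (_ : ball x d = set_val @^-1` ball (set_val x) d)//.
by rewrite ballEmdist.
Qed.

HB.instance Definition _ := @PseudoMetric_isMetric.Build R (set_type A)
  dist dist_ge0 dist_positivity ballEdist.

End subset_metric.

(* Nonemptiness is what makes the phase space a pointed, hence a measurable
   type; it also follows from the existence of a family of nonempty subsets
   of the phase space. *)
Record wasserstein_space (R : realType) (X : separableBanachType R) :=
  WassersteinSpace {
    ws_set :> set (P2 X) ;
    ws_neq0 : ws_set !=set0 }.

Section phase.
Context {R : realType} {X : separableBanachType R} (P : wasserstein_space X).

(* A named copy of the product, so that it carries the sum metric rather than
   the library's max one. *)
Definition phase : Type := (X * set_type P)%type.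

HB.instance Definition _ := gen_eqMixin phase.
HB.instance Definition _ := gen_choiceMixin phase.

Let dist (z w : phase) : R := `|z.1 - w.1| + W2 (\val z.2) (\val w.2).

Let distxx z : dist z z = 0.
Proof. by rewrite /dist subrr normr0 W2xx addr0. Qed.

Let dist_positivity z w : dist z w = 0 -> z = w.
Proof.
case: z w => [x p] [y q]; rewrite /dist /= => /eqP.
rewrite paddr_eq0 ?normr_ge0 ?sqrtr_ge0// normr_eq0 subr_eq0.
by move=> /andP[/eqP-> /eqP /W2_eq0/val_inj->].
Qed.

Let dist_sym z w : dist z w = dist w z.
Proof. by rewrite /dist distrC W2_sym. Qed.

Let dist_triangle w z v : dist z v <= dist z w + dist w v.
Proof.
rewrite /dist addrACA lerD ?W2_triangle//.
by rewrite -[leLHS]/(`|z.1 - v.1|) -(subrKA w.1) ler_normD.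
Qed.

HB.instance Definition _ :=
  isMetric.Build R phase distxx dist_positivity dist_sym dist_triangle.

Lemma mdist_phase (z w : phase) :
  mdist z w = `|z.1 - w.1| + mdist (\val z.2) (\val w.2).
Proof. by []. Qed.

Lemma phase_neq0 : exists z : phase, True.
Proof. by have [mu Pmu] := ws_neq0 P; exists (0, exist _ mu (mem_set Pmu)). Qed.

HB.instance Definition _ := isPointed.Build phase (sval (cid phase_neq0)).

End phase.

Section dynamics.
Context {R : realType} {d : measure_display} {Omega : measurableType d}.

Record metric_dynamical_system (Pr : probability Omega R)
    (theta : R -> Omega -> Omega) : Prop := {
  mds_measurable :
    measurable_fun setT (fun tw : R * Omega => theta tw.1 tw.2) ;
  mds0 : forall w, theta 0 w = w ;
  mdsD : forall s t w, theta (t + s) w = theta t (theta s w) ;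
  mds_invariant : forall t A, measurable A -> Pr (theta t @^-1` A) = Pr A }.

Context {X : separableBanachType R} {P : wasserstein_space X}.

(* [Phi t] is meaningful for [0 <= t] only. *)
Record continuous_rds (theta : R -> Omega -> Omega)
    (Phi : R -> Omega -> phase P -> phase P) : Prop := {
  rds_measurable :
    measurable_fun [set tz : R * Omega * borel (phase P) | 0 <= tz.1.1]
      (fun tz : R * Omega * borel (phase P) =>
         Phi tz.1.1 tz.1.2 tz.2 : borel (phase P)) ;
  rds0 : forall w z, Phi 0 w z = z ;
  rdsD : forall s t w z, 0 <= s -> 0 <= t ->
    Phi (t + s) w z = Phi t (theta s w) (Phi s w z) ;
  rds_continuous : forall t w, 0 <= t -> continuous (Phi t w) }.

Record family_universe (DX : set (Omega -> set X)) : Prop := {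
  family_universe_neq0 : forall B, DX B -> forall w, B w !=set0 ;
  family_universe_sub : forall B B', DX B ->
    (forall w, B' w !=set0) -> (forall w, B' w `<=` B w) -> DX B' }.

Record set_universe (DP : set (set (set_type P))) : Prop := {
  set_universe_neq0 : forall B, DP B -> B !=set0 ;
  set_universe_sub : forall B B', DP B -> B' !=set0 -> B' `<=` B -> DP B' }.

Definition product_universe (DX : set (Omega -> set X))
    (DP : set (set (set_type P))) : set (Omega -> set (phase P)) :=
  [set D | (forall w, D w !=set0) /\
    exists2 BX, DX BX & exists2 BP, DP BP &
      forall w, D w `<=` BX w `*` BP].

Definition dist_set (z : phase P) (C : set (phase P)) : R :=
  inf [set mdist z a | a in C].

Definition semidist (C1 C2 : set (phase P)) : \bar R :=
  ereal_sup [set (dist_set z C2)%:E | z in C1].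

Record random_closed_set (K : Omega -> set (phase P)) : Prop := {
  rcs_neq0 : forall w, K w !=set0 ;
  rcs_closed : forall w, closed (K w) ;
  rcs_measurable : forall z, measurable_fun setT (fun w => dist_set z (K w)) }.

Record random_compact_set (K : Omega -> set (phase P)) : Prop := {
  rks_closed : random_closed_set K ;
  rks_compact : forall w, compact (K w) }.

Section pullback.
Variables (theta : R -> Omega -> Omega)
  (Phi : R -> Omega -> phase P -> phase P).

Definition pullback (D : Omega -> set (phase P)) (t : R) (w : Omega) :
    set (phase P) :=
  Phi t (theta (- t) w) @` D (theta (- t) w).

Definition pullback_absorbing (DD : set (Omega -> set (phase P)))
    (K : Omega -> set (phase P)) : Prop :=
  forall D, DD D -> forall w, exists2 T : R, 0 <= T &
    forall t, T <= t -> pullback D t w `<=` K w.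

Definition pullback_asymptotically_compact
    (DD : set (Omega -> set (phase P))) : Prop :=
  forall D, DD D -> forall (w : Omega) (t : nat -> R) (z : nat -> phase P),
    (forall n, 0 <= t n) -> t n @[n --> \oo] --> +oo ->
    (forall n, D (theta (- t n) w) (z n)) ->
    exists2 k : nat -> nat, {homo k : m n / (m < n)%N} &
      exists z0 : phase P,
        Phi (t (k n)) (theta (- t (k n)) w) (z (k n)) @[n --> \oo] --> z0.

Record pullback_random_attractor (DD : set (Omega -> set (phase P)))
    (A : Omega -> set (phase P)) : Prop := {
  attractor_compact : random_compact_set A ;
  attractor_universe : DD A ;
  attractor_invariant : forall t w, 0 <= t ->
    Phi t w @` A w = A (theta t w) ;
  attractor_attracts : forall D, DD D -> forall w,
    semidist (pullback D t w) (A w) @[t --> +oo] --> 0%E }.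

Definition omega_limit (K : Omega -> set (phase P)) (w : Omega) :
    set (phase P) :=
  \bigcap_(tau in [set tau : R | 0 <= tau])
    closure (\bigcup_(t in [set t : R | tau <= t]) pullback K t w).

End pullback.
End dynamics.

(* Main.v *)
From HB Require Import structures.
Require Import Defs.
From mathcomp Require Import all_boot all_order all_algebra.
From mathcomp Require Import all_classical all_reals all_analysis.
From mathcomp Require Import measurable_realfun lra.

(** Everything rests on one observation about trajectories
    [Phi (t n) (theta (- t n) w) (z n)] with [t n] tending to infinity and
    starting points in a member of the universe. Cut off the last [tau] units
    of time: absorption puts the state reached at that moment into
    [K (theta (- tau) w)], so the trajectory ends in [pullback K tau w], and
    any limit lies in the closure of that set ([trajectory_limit]). Hence
    limits of trajectories belong to the omega-limit set [A w] of [K], and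
    [A w] itself lies in the closure of [pullback K tau w] for each single
    [tau]; taking [tau] beyond the absorption time of [K] gives that [A w] is
    contained in [K w], and so [A] belongs to the universe.

    Asymptotic compactness supplies the limits. It makes [A w] nonempty and
    sequentially compact, it gives attraction by contradiction, since
    trajectories staying away from [A w] would accumulate at a point of [A w],
    and it provides preimages for the inclusion of [A (theta t w)] in
    [Phi t w @` A w]. Uniqueness follows because an invariant set equals its
    own pullback images and is therefore contained in every closed set that
    attracts it ([invariant_sub_attracting]).

    Measurability of [A] must avoid the union over uncountably many times, as
    nothing is assumed on the continuity of [Phi] in time, and it must hold
    for a sigma-algebra that may be incomplete. The distance of [z] to [A w]
    is the limit of its distances to [pullback K n w] over the integers [n]
    ([dist_set_pullback_cvg]): the latter are no larger, since [A w] lies in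
    the closure of [pullback K n w], and asymptotic compactness keeps them from
    being smaller in the limit. For fixed [n] this distance is the infimum over
    the random closed set [K] of a function that is continuous in the state
    and measurable in the sample; balls around a countable dense set express
    such an infimum by countably many measurable conditions
    ([measurable_inf_random_set]), with no appeal to measurable selections. *)

Set Implicit Arguments.
Unset Strict Implicit.
Unset Printing Implicit Defensive.

Import Order.TTheory GRing.Theory Num.Theory.
Import numFieldNormedType.Exports.

Local Open Scope classical_set_scope.
Local Open Scope ring_scope.

(** * Metric spaces through sequences *)

Section metric_sequences.
Context {R : realType} {T : metricType R}.
Implicit Types (x y : T) (S : set T) (u : nat -> T).

Lemma cvg_mdistP u x : u n @[n --> \oo] --> x <->
  forall e : R, 0 < e -> \forall n \near \oo, mdist x (u n) < e.
Proof.
split=> [/cvg_ballP H e /H|H].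
  by apply: filterS => n; rewrite ballEmdist.
by apply/cvg_ballP => e /H; apply: filterS => n; rewrite ballEmdist.
Qed.

Lemma closure_mdistP S x : closure S x <->
  forall e : R, 0 < e -> exists2 y, S y & mdist x y < e.
Proof.
split=> [cSx e e0|H B /nbhs_ballP[e/= e0 eB]].
  have [y [Sy]] := cSx _ (nbhsx_ballx x e e0).
  by rewrite ballEmdist; exists y.
by have [y Sy xy] := H _ e0; exists y; split=> //; apply: eB; rewrite ballEmdist.
Qed.

Lemma nbhs_mdist_lt x y (r : R) : mdist y x < r ->
  nbhs x [set z | mdist y z < r].
Proof.
move=> yx; apply/nbhs_ballP; exists (r - mdist y x); first by rewrite /= subr_gt0.
move=> z; rewrite ballEmdist/= ltrBrDl; exact: le_lt_trans (metric_triangle _ _ _).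
Qed.

Lemma continuous_mdist x : continuous (mdist x : T -> R).
Proof.
move=> y; apply/cvgrPdist_lt => e e0.
have yy : mdist y y < e by rewrite mdistxx.
apply: filterS (nbhs_mdist_lt yy) => z /= yz.
have := metric_triangle x y z; have := metric_triangle x z y.
by rewrite (metric_sym z) ltr_norml; lra.
Qed.

Lemma nearby_cvg u (v : nat -> T) x :
  (forall n, mdist (v n) (u n) < n.+1%:R^-1) ->
  v n @[n --> \oo] --> x -> u n @[n --> \oo] --> x.
Proof.
move=> vu /cvg_mdistP vx; apply/cvg_mdistP => e e0.
have e20 : 0 < e / 2 by rewrite divr_gt0.
near=> n; rewrite (le_lt_trans (metric_triangle _ (v n) _))//.
rewrite [ltRHS]splitr ltrD//; first by near: n; exact: vx.
rewrite (lt_trans (vu n))//; near: n.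
exact: (near_infty_natSinv_lt (PosNum e20)).
Unshelve. all: by end_near. Qed.

Lemma homo_ltn_ge (k : nat -> nat) : {homo k : m n / (m < n)%N} ->
  forall n, (n <= k n)%N.
Proof.
move=> kh; elim=> // n IH.
by rewrite (leq_ltn_trans IH)// kh.
Qed.

Lemma homo_ltn_cvg (k : nat -> nat) : {homo k : m n / (m < n)%N} ->
  k n @[n --> \oo] --> \oo.
Proof.
move=> kh A [N _ NA]; exists N => // n /= Nn; apply: NA => /=.
exact: leq_trans Nn (homo_ltn_ge kh n).
Qed.

(** If a filter on [A] had no cluster point in [A], every point of [A] would
    lie in a ball with rational radius about a point of the dense sequence
    whose complement belongs to the filter. These balls form a sequence
    covering [A], and none of its finite parts covers [A]; a sequence in [A]
    that avoids more and more of them has no subsequence converging in [A]. *)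
Lemma sequentially_compact (e : nat -> T) (A : set T) :
  (forall x (r : R), 0 < r -> exists n, mdist x (e n) < r) ->
  (forall u, (forall n, A (u n)) ->
    exists2 k : nat -> nat, {homo k : m n / (m < n)%N} &
      exists2 a, A a & u (k n) @[n --> \oo] --> a) ->
  compact A.
Proof.
move=> eP seqA F FF FA; apply: contrapT => noA.
pose V (p : nat * nat) := [set x | mdist (e p.1) x < p.2.+1%:R^-1].
(* The [n]-th rational ball when its complement belongs to [F], and the empty
   set otherwise, so that every [~` W n] belongs to [F]. *)
pose W n := if @unpickle (nat * nat)%type n is Some p then
  [set x | V p x /\ F (~` V p)] else set0.
have FW n : F (~` W n).
  rewrite /W; case: unpickle => [p|]; last by rewrite setC0; exact: filterT.
  have [FV|nFV] := pselect (F (~` V p)).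
    by apply: filterS FV => x nV [].
  by apply: filterE => x [].
have FWn n : F [set x | forall i, (i < n)%N -> ~ W i x].
  elim: n => [|n IH]; first exact: filterE.
  apply: filterS2 IH (FW n) => x Wx Wnx i.
  by rewrite ltnS leq_eqVlt => /orP[/eqP->|/Wx].
have AW n : exists a, A a /\ forall i, (i < n)%N -> ~ W i a.
  have [a [Aa aW]] := filter_ex (filterI FA (FWn n)).
  by exists a.
have [u uP] := choice AW.
have [k kh [a Aa ua]] := seqA u (fun n => (uP n).1).
have [N WNa] : exists N, nbhs a (W N).
  have [B [U [FB aU BU]]] : exists B U, [/\ F B, nbhs a U & B `&` U = set0].
    apply: contrapT => noBU; apply: noA; exists a; split => // B U FB aU.
    by apply/set0P/negP => /eqP BU; apply: noBU; exists B, U.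
  move/nbhs_ballP : aU => [r/= r0 rU].
  have r20 : 0 < r / 2 by rewrite divr_gt0.
  have [m _ /(_ m (leqnn m))/= mr] := near_infty_natSinv_lt (PosNum r20).
  have m0 : 0 < m.+1%:R^-1 :> R by rewrite invr_gt0.
  have [j aj] := eP a _ m0.
  exists (pickle (j, m)); rewrite /W pickleK.
  have FV : F (~` V (j, m)).
    apply: filterS FB => y By Vy.
    suff : (B `&` U) y by rewrite BU.
    split => //; apply: rU; rewrite ballEmdist/=.
    apply: le_lt_trans (metric_triangle _ (e j) _) _.
    rewrite [ltRHS]splitr ltrD ?(lt_trans aj)//.
    exact: lt_trans mr.
  apply: filterS (@nbhs_mdist_lt a (e j) m.+1%:R^-1 _) => //.
  by rewrite metric_sym.
have [n [WNn Nn]] : exists n, W N (u (k n)) /\ (N < n)%N.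
  apply: (@filter_ex _ (\oo)); apply: filterI; first exact: ua.
  exact: nbhs_infty_gt.
exact: (uP (k n)).2 _ (leq_trans Nn (homo_ltn_ge kh n)) WNn.
Qed.

Lemma separable_sequence : T -> separable T ->
  exists e : nat -> T, forall x (r : R), 0 < r -> exists n, mdist x (e n) < r.
Proof.
move=> x0 [D cD dD].
have nearD x (r : R) : 0 < r -> exists2 y, D y & mdist x y < r.
  move=> r0; have [|y [xy Dy]] := dD (ball x r)°%classic _ (open_interior _).
    by exists x; apply: nbhsx_ballx.
  by exists y => //; move: (interior_subset xy); rewrite ballEmdist.
pose Tp : pointedType := HB.pack T (isPointed.Build T x0).
have /(@pcard_surjP Tp)[e eD] := cD.
exists e => x r /(nearD x)[y Dy xy].
by have [n _ eny] := eD _ Dy; exists n; rewrite eny.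
Qed.

End metric_sequences.

(** * Distance functions of random sets *)

Section distance_to_a_set.
Context {R : realType} {X : separableBanachType R} {P : wasserstein_space X}.
Implicit Types (z a : phase P) (C : set (phase P)).

Lemma inf_lt_nnegP (I : Type) (C : set I) (f : I -> R) (r : R) :
  C !=set0 -> (forall i, 0 <= f i) ->
  inf [set f i | i in C] < r <-> exists2 i, C i & f i < r.
Proof.
move=> [c Cc] f0; split=> [/inf_lt[|_ [i Ci <-]]|[i Ci]].
- by exists (f c), c.
- by exists i.
- apply: le_lt_trans; apply: ge_inf; last by exists i.
  by exists 0 => _ [j _ <-].
Qed.

Lemma dist_set_ltP z C (r : R) : C !=set0 ->
  dist_set z C < r <-> exists2 a, C a & mdist z a < r.
Proof. by move=> C0; apply: inf_lt_nnegP => // a; exact: mdist_ge0. Qed.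

Lemma dist_set_ge0 z C : 0 <= dist_set z C.
Proof.
have [C0|/set0P C0] := eqVneq C set0.
  by rewrite /dist_set C0 image_set0 inf0.
by rewrite leNgt; apply/negP => /(dist_set_ltP _ _ C0)[a _];
  rewrite ltNge mdist_ge0.
Qed.

Lemma dist_set_le z C a : C a -> dist_set z C <= mdist z a.
Proof.
by move=> Ca; apply: ge_inf; [exists 0 => _ [b _ <-]; exact: mdist_ge0|exists a].
Qed.

Lemma closure_dist_set z C : C !=set0 -> closure C z <-> dist_set z C = 0.
Proof.
move=> C0; split=> [/closure_mdistP cz|z0].
  apply/eqP; rewrite eq_le dist_set_ge0 andbT; apply/ler_addgt0Pr => e /cz.
  by move=> /(dist_set_ltP _ _ C0)/ltW; rewrite add0r.
by apply/closure_mdistP => e e0; apply/dist_set_ltP => //; rewrite z0.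
Qed.

Lemma dist_set_closure z C : C !=set0 -> dist_set z (closure C) = dist_set z C.
Proof.
move=> C0; have cC0 : closure C !=set0.
  by have [c Cc] := C0; exists c; exact: subset_closure.
apply/eqP; rewrite eq_le; apply/andP; split.
  apply/ler_addgt0Pr => e e0; apply/ltW/dist_set_ltP => //.
  have /(dist_set_ltP _ _ C0)[a Ca za] : dist_set z C < dist_set z C + e.
    by rewrite ltrDl.
  by exists a => //; exact: subset_closure.
apply: lb_le_inf; first by have [c ?] := cC0; exists (mdist z c), c.
move=> _ [a /closure_mdistP ca <-]; apply/ler_addgt0Pr => e /ca[b Cb ab].
apply: le_trans (dist_set_le _ Cb) _; apply: le_trans (metric_triangle _ a _) _.
by rewrite lerD2l ltW.
Qed.

Lemma phase_dense_sequence : separable (set_type P) ->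
  exists e : nat -> phase P,
    forall z (r : R), 0 < r -> exists n, mdist z (e n) < r.
Proof.
have [eX eXP] := @dense_sequence R X.
move=> /(separable_sequence (point : phase P).2)[eP ePP].
pose e n : phase P := let p := odflt (0, 0)%N (unpickle n) in (eX p.1, eP p.2).
exists e => z r r0; have r20 : 0 < r / 2 by rewrite divr_gt0.
have [i zi] := eXP z.1 _ r20; have [j zj] := ePP z.2 _ r20.
exists (pickle (i, j)); rewrite mdist_phase /e pickleK/=.
by rewrite [ltRHS]splitr ltrD.
Qed.

End distance_to_a_set.

Section measurable_distance.
Context {R : realType} {d : measure_display} {Omega : measurableType d}.
Context {X : separableBanachType R} {P : wasserstein_space X}.

Lemma measurable_lt_fun (f : Omega -> R) :
  (forall r, measurable [set w | f w < r]) -> measurable_fun setT f.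
Proof.
move=> mf _; apply: (measurability _ (RGenInftyO.measurableE R)) => //.
move=> _ [_ [r ->] <-]; rewrite setTI (_ : _ @^-1` _ = [set w | f w < r])//.
Qed.

Lemma measurable_fun_lt (f : Omega -> R) r : measurable_fun setT f ->
  measurable [set w | f w < r].
Proof.
move=> mf; rewrite (_ : [set w | _] = setT `&` f @^-1` `]-oo, r[%classic).
  exact: mf.
by rewrite setTI; apply/seteqP; split => w /=; rewrite in_itv.
Qed.

(** The infimum lies below [r] when a point of [C w] satisfies [f w x < r].
    By continuity of [f w], a whole ball of rational radius around a dense
    point [e j] then meets [C w] and satisfies [f w <= r - l.+1^-1]. The former
    is a condition on the distance of [e j] to [C w]; the latter needs
    checking at the dense points of the ball only. *)
Lemma measurable_inf_random_set (f : Omega -> phase P -> R)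
    (C : Omega -> set (phase P)) :
  separable (set_type P) ->
  (forall w x, 0 <= f w x) ->
  (forall x, measurable_fun setT (f ^~ x)) ->
  (forall w, continuous (f w)) ->
  (forall w, C w !=set0) ->
  (forall z, measurable_fun setT (fun w => dist_set z (C w))) ->
  measurable_fun setT (fun w => inf [set f w x | x in C w]).
Proof.
move=> /phase_dense_sequence[e eP] f0 mf cf C0 mC.
apply: measurable_lt_fun => r.
rewrite (_ : [set w | _] = \bigcup_j \bigcup_k \bigcup_l
   ([set w | dist_set (e j) (C w) < k.+1%:R^-1] `&`
    \bigcap_i [set w | mdist (e j) (e i) < k.+1%:R^-1 ->
                       f w (e i) <= r - l.+1%:R^-1])).
  apply: bigcupT_measurable => j; apply: bigcupT_measurable => k.
  apply: bigcupT_measurable => l.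
  apply: measurableI; first exact: measurable_fun_lt.
  apply: bigcapT_measurable => i.
  case: (ltP (mdist _ _) _) => _; last first.
    by rewrite (_ : mkset _ = setT)//; apply/seteqP; split.
  rewrite (_ : mkset _ = ~` [set w | - f w (e i) < - (r - l.+1%:R^-1)]).
    by apply: measurableC; apply: measurable_fun_lt; exact: measurable_funN.
  apply/seteqP; split => w /=; rewrite ltrN2 => H.
    by move: (H isT); rewrite leNgt => /negP.
  by move=> _; rewrite leNgt; apply/negP.
apply/seteqP; split => w /=.
  (* The slack [l.+1^-1] keeps the strict bound at [x] on a ball around it. *)
  move=> /(inf_lt_nnegP _ (C0 w) (f0 w))[x Cx].
  move=> /ltr_add_invr[l xl].
  have xl' : f w x < r - l.+1%:R^-1 by rewrite ltrBrDr.
  have /nbhs_ballP[s/= s0 sP] : nbhs x [set y | f w y < r - l.+1%:R^-1].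
    exact: (cf w x _ (lt_nbhsl xl')).
  have s20 : 0 < s / 2 by rewrite divr_gt0.
  have [k _ /(_ k (leqnn k))/= ks] := near_infty_natSinv_lt (PosNum s20).
  have k0 : 0 < k.+1%:R^-1 :> R by rewrite invr_gt0.
  have [j xj] := eP x _ k0.
  exists j => //; exists k => //; exists l => //; split=> [|i _ /= ji].
    by apply/dist_set_ltP => //; exists x => //; rewrite metric_sym.
  apply/ltW/sP; rewrite ballEmdist/=; apply: le_lt_trans (metric_triangle _ (e j) _) _.
  by rewrite [ltRHS]splitr ltrD ?(lt_trans xj)// (lt_trans ji).
move=> [j _ [k _ [l _ [/(dist_set_ltP _ _ (C0 w))[x Cx jx] H]]]].
apply/inf_lt_nnegP => //; exists x => //.
apply: (@le_lt_trans _ _ (r - l.+1%:R^-1)); last first.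
  by rewrite ltrBlDr ltrDl invr_gt0.
rewrite leNgt; apply/negP => /lt_nbhsr/(cf w x) fx.
have /nbhs_ballP[s/= s0 sP] : nbhs x ([set y | r - l.+1%:R^-1 < f w y] `&`
    [set y | mdist (e j) y < k.+1%:R^-1]).
  by apply: filterI => //; exact: nbhs_mdist_lt.
have [i xi] := eP x _ s0.
have [] := sP (e i); first by rewrite ballEmdist.
by move=> /= fi /(H i I); rewrite leNgt fi.
Qed.

End measurable_distance.

(** * Pullback omega-limit sets *)

Section omega_limit_sets.
Context {R : realType} {d : measure_display} {Omega : measurableType d}.
Context {X : separableBanachType R} {P : wasserstein_space X}.
Variables (Pr : probability Omega R) (theta : R -> Omega -> Omega)
  (Phi : R -> Omega -> phase P -> phase P).
Hypothesis mds_theta : metric_dynamical_system Pr theta.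
Hypothesis rds_Phi : continuous_rds theta Phi.
Implicit Types (A B D K : Omega -> set (phase P)) (w : Omega) (z a : phase P).

Lemma shift_shift s t w : theta s (theta t w) = theta (s + t) w.
Proof. by rewrite (mdsD mds_theta). Qed.

Lemma rds_split s t w z : 0 <= s -> 0 <= t ->
  Phi (s + t) (theta (- (s + t)) w) z =
  Phi s (theta (- s) w) (Phi t (theta (- t) (theta (- s) w)) z).
Proof.
move=> s0 t0; rewrite (rdsD rds_Phi)// !shift_shift.
by congr (Phi _ (theta _ _) (Phi _ (theta _ _) _)); lra.
Qed.

Lemma rds_shift s t w z : 0 <= s -> 0 <= t ->
  Phi (s + t) (theta (- (s + t)) (theta s w)) z =
  Phi s w (Phi t (theta (- t) w) z).
Proof.
move=> s0 t0; rewrite rds_split// shift_shift addNr.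
by rewrite (mds0 mds_theta).
Qed.

(** Beyond the absorption time at [theta (- tau) w], a trajectory started in
    [D] spends its last [tau] units of time inside the image of [K]. *)
Lemma trajectory_limit DD K D w (t : nat -> R) (z : nat -> phase P) a :
  pullback_absorbing theta Phi DD K -> DD D ->
  t n @[n --> \oo] --> +oo ->
  (forall n, D (theta (- t n) w) (z n)) ->
  Phi (t n) (theta (- t n) w) (z n) @[n --> \oo] --> a ->
  forall tau, 0 <= tau -> closure (pullback theta Phi K tau w) a.
Proof.
move=> absK DDD toy Dz cva tau tau0.
have [T T0 TK] := absK D DDD (theta (- tau) w).
apply: (@closed_cvg _ _ \oo _
  (fun n => Phi (t n) (theta (- t n) w) (z n)) _ _ _ _ cva).
  exact: closed_closure.
have /cvgryPge/(_ (tau + T)) tT := toy.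
apply: filterS tT => n tTn; apply: subset_closure.
have tn : t n = tau + (t n - tau) by lra.
have ts0 : 0 <= t n - tau by lra.
exists (Phi (t n - tau) (theta (- (t n - tau)) (theta (- tau) w)) (z n)).
  apply: (TK (t n - tau)); first by lra.
  exists (z n) => //.
  by rewrite shift_shift (_ : _ + _ = - t n); [exact: Dz|lra].
by rewrite -rds_split// -tn.
Qed.

Lemma trajectory_limit_omega DD K D w (t : nat -> R) (z : nat -> phase P) a :
  pullback_absorbing theta Phi DD K -> DD D ->
  t n @[n --> \oo] --> +oo ->
  (forall n, D (theta (- t n) w) (z n)) ->
  Phi (t n) (theta (- t n) w) (z n) @[n --> \oo] --> a ->
  omega_limit theta Phi K w a.
Proof.
move=> absK DDD toy Dz cva tau tau0.
apply: closure_subset (trajectory_limit absK DDD toy Dz cva tau0).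
by move=> y Ky; exists tau => /=.
Qed.

Lemma cvgy_ge_nat (t : nat -> R) (c : R) : (forall n, n%:R + c <= t n) ->
  t n @[n --> \oo] --> +oo.
Proof.
move=> tn; apply/cvgryPge => A.
have := @nbhs_infty_ger R (A - c); apply: filterS => n.
by move=> nA; apply: le_trans (tn n); rewrite -lerBlDr.
Qed.

(** The margin [c] leaves room to cut the last [c] units of time off the
    trajectories. *)
Lemma omega_limit_trajectory K w a (c : R) : 0 <= c ->
  omega_limit theta Phi K w a ->
  exists (t : nat -> R) (z : nat -> phase P),
    [/\ forall n, n%:R + c <= t n, forall n, K (theta (- t n) w) (z n) &
      Phi (t n) (theta (- t n) w) (z n) @[n --> \oo] --> a].
Proof.
move=> c0 wa.
have step n : exists tz : R * phase P, [/\ n%:R + c <= tz.1,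
    K (theta (- tz.1) w) tz.2 &
    mdist a (Phi tz.1 (theta (- tz.1) w) tz.2) < n.+1%:R^-1].
  have nc0 : 0 <= n%:R + c by rewrite addr_ge0.
  have n0 : 0 < n.+1%:R^-1 :> R by rewrite invr_gt0.
  have [_ [t /= ct [z Kz <-]] az] := (closure_mdistP _ _).1 (wa _ nc0) _ n0.
  by exists (t, z).
have [tz tzP] := choice step.
exists (fst \o tz), (snd \o tz); split=> [n|n|]; try by have [] := tzP n.
apply: (@nearby_cvg _ _ _ (fun=> a)); last exact: cvg_cst.
by move=> n; have [] := tzP n.
Qed.

(** Trajectories leaving from an absorbing [K] end up in [K] itself: a single
    time [tau], in place of the union over all later times, already confines
    the omega-limit set. *)
Lemma omega_limit_sub_pullback DD K w tau :
  pullback_absorbing theta Phi DD K -> DD K -> 0 <= tau ->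
  omega_limit theta Phi K w `<=` closure (pullback theta Phi K tau w).
Proof.
move=> absK DDK tau0 a /(omega_limit_trajectory (lexx 0))[t [z [tn Kz cva]]].
exact: trajectory_limit absK DDK (cvgy_ge_nat tn) Kz cva tau tau0.
Qed.

Lemma omega_limit_sub_absorbing DD K w : pullback_absorbing theta Phi DD K ->
  DD K -> closed (K w) -> omega_limit theta Phi K w `<=` K w.
Proof.
move=> absK DDK cK a wa; apply: cK.
have [T T0 TK] := absK K DDK w.
by apply: closure_subset (omega_limit_sub_pullback absK DDK T0 wa); exact: TK.
Qed.

Lemma closed_omega_limit K w : closed (omega_limit theta Phi K w).
Proof. by apply: closed_bigI => tau _; exact: closed_closure. Qed.

(** An invariant set is its own pullback image at all times, so that its
    distance to an attracting set does not depend on time and must vanish.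
    Two attractors therefore contain one another. *)
Lemma invariant_sub_attracting A B w :
  (forall t w, 0 <= t -> Phi t w @` A w = A (theta t w)) ->
  B w !=set0 -> closed (B w) ->
  semidist (pullback theta Phi A t w) (B w) @[t --> +oo] --> 0%E ->
  A w `<=` B w.
Proof.
move=> A_inv B0 cB attr a Aa; apply: cB; apply/closure_dist_set => //.
apply/eqP; rewrite eq_le dist_set_ge0 andbT -lee_fin.
apply: cvge_to_ge attr _; near=> t; apply: ereal_sup_ubound.
exists a => //; have t0 : 0 <= t by near: t; exact: nbhs_pinfty_ge.
by rewrite /pullback A_inv// shift_shift subrr (mds0 mds_theta).
Unshelve. all: by end_near. Qed.

Section asymptotically_compact.
Variables (DD : set (Omega -> set (phase P))) (K : Omega -> set (phase P)).
Hypothesis absK : pullback_absorbing theta Phi DD K.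
Hypothesis acPhi : pullback_asymptotically_compact theta Phi DD.
Local Notation A := (omega_limit theta Phi K).

Lemma trajectory_subsequence D w (t : nat -> R) (z : nat -> phase P) :
  DD D -> (forall n, n%:R <= t n) -> (forall n, D (theta (- t n) w) (z n)) ->
  exists2 k : nat -> nat, {homo k : m n / (m < n)%N} &
    exists2 a, A w a &
      Phi (t (k n)) (theta (- t (k n)) w) (z (k n)) @[n --> \oo] --> a.
Proof.
move=> DDD tn Dz.
have t0 n : 0 <= t n by apply: le_trans (tn n).
have toy : t n @[n --> \oo] --> +oo.
  by apply: (@cvgy_ge_nat _ 0) => n; rewrite addr0.
have [k kh [a cva]] := acPhi DDD t0 toy Dz.
exists k => //; exists a => //.
apply: trajectory_limit_omega absK DDD _ _ cva.
  exact: cvg_comp (homo_ltn_cvg kh) toy.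
by move=> n; exact: Dz.
Qed.

Lemma omega_limit_neq0 D w : DD D -> (forall w, D w !=set0) -> A w !=set0.
Proof.
move=> DDD D0; have [z zP] := choice (fun n : nat => D0 (theta (- n%:R) w)).
by have [k _ [a Aa _]] := trajectory_subsequence DDD (fun=> lexx _) zP; exists a.
Qed.

(** Each point of a sequence in the omega-limit set lies ever closer to a
    trajectory of ever longer duration; asymptotic compactness applies to
    these trajectories. *)
Lemma compact_omega_limit w : separable (set_type P) -> DD K -> compact (A w).
Proof.
move=> /phase_dense_sequence[e eP] DDK; apply: (sequentially_compact eP) => u Au.
have step n : exists tz : R * phase P, [/\ n%:R <= tz.1,
    K (theta (- tz.1) w) tz.2 &
    mdist (Phi tz.1 (theta (- tz.1) w) tz.2) (u n) < n.+1%:R^-1].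
  have n0 : 0 < n.+1%:R^-1 :> R by rewrite invr_gt0.
  have [_ [t /= ct [z Kz <-]] az] :=
    (closure_mdistP _ _).1 (Au n _ (ler0n _ n)) _ n0.
  by exists (t, z); rewrite metric_sym.
have [tz tzP] := choice step.
have [||k kh [a Aa cva]] :=
    @trajectory_subsequence K w (fst \o tz) (snd \o tz) DDK.
- by move=> n; have [] := tzP n.
- by move=> n; have [] := tzP n.
exists k => //; exists a => //; apply: nearby_cvg cva => n /=.
have [_ _ /lt_le_trans-> //] := tzP (k n).
by rewrite lef_pV2 ?posrE// ler_nat ltnS homo_ltn_ge.
Qed.

(** Forward invariance holds because [Phi t w] sends a pullback trajectory
    over [w] to a longer one over [theta t w]. Conversely, cutting the last [t]
    units of time from a trajectory over [theta t w] leaves one over [w], whose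
    limit exists along a subsequence by asymptotic compactness. *)
Lemma omega_limit_invariant t w : DD K -> 0 <= t ->
  Phi t w @` A w = A (theta t w).
Proof.
move=> DDK t0; apply/seteqP; split.
  move=> _ [a /(omega_limit_trajectory (lexx 0))[s [z [sn Kz cva]]] <-].
  have s0 n : 0 <= s n by apply: le_trans (sn n); rewrite addr0.
  have back n : theta (- (t + s n)) (theta t w) = theta (- s n) w.
    by rewrite shift_shift; congr theta; lra.
  apply: (@trajectory_limit_omega DD K K _ (fun n => t + s n) z) => //.
  - by apply: (@cvgy_ge_nat _ 0) => n; rewrite (le_trans (sn n))// lerDr.
  - by move=> n; rewrite back.
  rewrite (_ : (fun n => _) =
      Phi t w \o (fun n => Phi (s n) (theta (- s n) w) (z n))).
    apply: cvg_comp cva _; exact: (rds_continuous rds_Phi).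
  by apply/funext => n /=; rewrite rds_shift.
move=> b /(omega_limit_trajectory t0)[s [z [sn Kz cvb]]].
have back n : theta (- (s n - t)) w = theta (- s n) (theta t w).
  by rewrite shift_shift; congr theta; lra.
have [||k kh [a Aa cva]] := @trajectory_subsequence K w (fun n => s n - t) z DDK.
- by move=> n; rewrite lerBrDr.
- by move=> n; rewrite back.
exists a => //.
have cvPhi := cvg_comp _ _ cva (@rds_continuous _ _ _ _ _ _ _ rds_Phi t w t0 a).
have cvbk := cvg_comp _ _ (homo_ltn_cvg kh) cvb.
apply: (cvg_unique (metric_hausdorff (T := phase P)) cvPhi).
rewrite (_ : Phi t w \o _ =
  (fun n => Phi (s n) (theta (- s n) (theta t w)) (z n)) \o k)//.
apply/funext => n /=.
have skt : 0 <= s (k n) - t.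
  by rewrite subr_ge0 (le_trans _ (sn (k n)))// lerDr.
have sk : s (k n) = t + (s (k n) - t) by lra.
by rewrite -rds_shift// -sk.
Qed.

Lemma omega_limit_attracts D w : DD D -> (forall w, D w !=set0) ->
  semidist (pullback theta Phi D t w) (A w) @[t --> +oo] --> 0%E.
Proof.
move=> DDD D0.
have A0 : A w !=set0 by exact: omega_limit_neq0 DDD D0.
have sd0 t : (0 <= semidist (pullback theta Phi D t w) (A w))%E.
  have [z Dz] := D0 (theta (- t) w).
  apply: (@le_trans _ _ (dist_set (Phi t (theta (- t) w) z) (A w))%:E).
    by rewrite lee_fin dist_set_ge0.
  by apply: ereal_sup_ubound; exists (Phi t (theta (- t) w) z) => //; exists z.
have sde (e : R) : 0 < e -> \forall t \near +oo,
    (semidist (pullback theta Phi D t w) (A w) <= e%:E)%E.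
  move=> e0; apply: contrapT => nT.
  have step (n : nat) : exists tz : R * phase P, [/\ n%:R <= tz.1,
      D (theta (- tz.1) w) tz.2 &
      e < dist_set (Phi tz.1 (theta (- tz.1) w) tz.2) (A w)].
    apply: contrapT => notz; apply: nT; exists n%:R; split => // t /ltW nt.
    apply: ge_ereal_sup => _ [_ [z Dz <-] <-]; rewrite lee_fin leNgt.
    by apply/negP => ez; apply: notz; exists (t, z).
  have [tz tzP] := choice step.
  have [||k kh [a Aa /cvg_mdistP/(_ e e0)]] :=
      @trajectory_subsequence D w (fst \o tz) (snd \o tz) DDD.
  - by move=> n; have [] := tzP n.
  - by move=> n; have [] := tzP n.
  move=> [n _ /(_ n (leqnn n))/= aen].
  have [_ _] := tzP (k n); rewrite ltNge => /negP; apply.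
  by rewrite (le_trans (dist_set_le _ Aa))// metric_sym ltW.
apply/fine_cvgP; split.
  apply: filterS (sde 1 ltr01) => t st1.
  by rewrite ge0_fin_numE// (le_lt_trans st1)// ltry.
apply/cvgrPdist_le => e e0; apply: filterS (sde e e0) => t ste.
rewrite sub0r normrN ger0_norm ?fine_ge0// -lee_fin fineK//.
by rewrite ge0_fin_numE// (le_lt_trans ste)// ltry.
Qed.

(** The omega-limit set sits in the closure of every [pullback K n w]; if the
    distances from [z] to those were below [dist_set z (A w) - e] for
    arbitrarily large [n], points realizing this would be ends of trajectories
    and, by asymptotic compactness, accumulate at a point of [A w] that is too
    close to [z]. *)
Lemma dist_set_pullback_cvg z w : DD K -> (forall w, K w !=set0) ->
  dist_set z (pullback theta Phi K n%:R w) @[n --> \oo] --> dist_set z (A w).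
Proof.
move=> DDK K0; have A0 : A w !=set0 by exact: omega_limit_neq0 DDK K0.
have pb0 t : pullback theta Phi K t w !=set0.
  by have [y Ky] := K0 (theta (- t) w); exists (Phi t (theta (- t) w) y), y.
have up (n : nat) : dist_set z (pullback theta Phi K n%:R w) <= dist_set z (A w).
  rewrite -(dist_set_closure _ (pb0 _)); apply: lb_le_inf.
    by have [a Aa] := A0; exists (mdist z a), a.
  move=> _ [a Aa <-]; apply: dist_set_le.
  exact: omega_limit_sub_pullback absK DDK _ _ Aa.
apply/cvgrPdist_le => e e0; apply: contrapT => nN.
have step N : exists ny : nat * phase P, [/\ (N <= ny.1)%N,
    K (theta (- ny.1%:R) w) ny.2 &
    mdist z (Phi ny.1%:R (theta (- ny.1%:R) w) ny.2) < dist_set z (A w) - e].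
  apply: contrapT => noy; apply: nN; exists N => // n /= Nn.
  rewrite ger0_norm ?subr_ge0// lerBlDr -lerBlDl leNgt; apply/negP.
  by move=> /(dist_set_ltP _ _ (pb0 _))[_ [y Ky <-] zy]; apply: noy; exists (n, y).
have [ny nyP] := choice step.
have [||k kh [a Aa /cvg_mdistP/(_ e e0)]] :=
    @trajectory_subsequence K w (fun n => (ny n).1%:R) (snd \o ny) DDK.
- by move=> n; have [] := nyP n; rewrite ler_nat.
- by move=> n; have [] := nyP n.
move=> [n _ /(_ n (leqnn n))/= aen].
have [_ _ zn] := nyP (k n).
have := dist_set_le z Aa; rewrite leNgt => /negP; apply.
pose y := Phi (ny (k n)).1%:R (theta (- (ny (k n)).1%:R) w) (ny (k n)).2.
apply: le_lt_trans (metric_triangle z y a) _.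
have ya : mdist y a < e by rewrite metric_sym.
have zy : mdist z y < dist_set z (A w) - e by [].
by rewrite -(subrK e (dist_set z (A w))) ltrD.
Qed.

End asymptotically_compact.

(** * Measurability along the dynamics *)

Lemma measurable_mdist z :
  measurable_fun setT (fun x : borel (phase P) => mdist z (x : phase P)).
Proof.
apply: measurable_lt_fun => r; apply: sub_sigma_algebra.
by move=> x /= zx; exact: nbhs_mdist_lt.
Qed.

Lemma measurable_shift t : measurable_fun setT (theta t).
Proof.
exact: measurableT_comp (mds_measurable mds_theta) (pair1_measurable t).
Qed.

Lemma measurable_rds_state t x : 0 <= t ->
  measurable_fun setT (fun w => Phi t w x : borel (phase P)).
Proof.
move=> t0.
have mD : measurable [set tz : R * Omega * borel (phase P) | 0 <= tz.1.1].
  rewrite (_ : mkset _ = setT `&` (fst \o fst) @^-1` `[0, +oo[%classic).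
    have m : measurable_fun setT
        (fst \o fst : R * Omega * borel (phase P) -> R).
      exact: measurableT_comp.
    exact: m.
  by rewrite setTI; apply/seteqP; split => -[[s w] y] /=; rewrite in_itv/= andbT.
apply: (@measurable_comp _ _ _ _ _ _ _ _ _
  (fun w : Omega => ((t, w), x : borel (phase P))) mD _ (rds_measurable rds_Phi)).
  by move=> _ [w _ <-].
apply: measurable_fun_pair; last exact: measurable_cst.
exact: pair1_measurable.
Qed.

Lemma measurable_dist_pullback K t z : separable (set_type P) -> 0 <= t ->
  random_closed_set K ->
  measurable_fun setT (fun w => dist_set z (pullback theta Phi K t w)).
Proof.
move=> sP t0 [K0 _ mK].
have -> : (fun w => dist_set z (pullback theta Phi K t w)) =
    (fun w => inf [set mdist z (Phi t w x) | x in K w]) \o theta (- t).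
  by apply/funext => w /=; rewrite /dist_set /pullback image_comp.
apply: measurableT_comp (measurable_shift _).
apply: measurable_inf_random_set => // [w x|x|w x].
- exact: mdist_ge0.
- exact: measurableT_comp (measurable_mdist z) (measurable_rds_state x t0).
apply: continuous_comp; first exact: (rds_continuous rds_Phi).
exact: continuous_mdist.
Qed.

End omega_limit_sets.

(** * The attractor *)

Theorem theorem2p3 (R : realType) (d : measure_display)
    (Omega : measurableType d) (Pr : probability Omega R)
    (theta : R -> Omega -> Omega)
    (X : separableBanachType R) (P : wasserstein_space X)
    (DX : set (Omega -> set X)) (DP : set (set (set_type P)))
    (Phi : R -> Omega -> phase P -> phase P)
    (K : Omega -> set (phase P))
    (mds_theta : metric_dynamical_system Pr theta)
    (P_separable : separable (set_type P))
    (P_complete : complete_uniform (set_type P))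
    (DX_universe : family_universe DX) (DP_universe : set_universe DP)
    (rds_Phi : continuous_rds theta Phi)
    (K_closed : random_closed_set K)
    (K_universe : product_universe DX DP K)
    (K_absorbing : pullback_absorbing theta Phi (product_universe DX DP) K)
    (Phi_compact :
      pullback_asymptotically_compact theta Phi (product_universe DX DP)) :
  unique (pullback_random_attractor theta Phi (product_universe DX DP))
    (omega_limit theta Phi K) /\
  (forall w, omega_limit theta Phi K w `<=` K w).
Proof.
have [K0 [BX DBX [BP DBP KB]]] := K_universe.
have AK w : omega_limit theta Phi K w `<=` K w.
  apply: (omega_limit_sub_absorbing mds_theta rds_Phi K_absorbing K_universe).
  exact: (rcs_closed K_closed).
have A0 w : omega_limit theta Phi K w !=set0.
  exact: (omega_limit_neq0 mds_theta rds_Phi K_absorbing Phi_compact w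
    K_universe K0).
have AD : product_universe DX DP (omega_limit theta Phi K).
  split => //; exists BX => //; exists BP => // w; apply: subset_trans (KB w).
  exact: AK.
have cA w : closed (omega_limit theta Phi K w).
  exact: closed_omega_limit.
have A_inv t w : 0 <= t -> Phi t w @` omega_limit theta Phi K w =
    omega_limit theta Phi K (theta t w).
  exact: (omega_limit_invariant mds_theta rds_Phi K_absorbing Phi_compact).
split => //; split=> [|B [B_compact BD B_inv B_attr]].
  split=> //.
  - split=> [|w]; last first.
      exact: (compact_omega_limit mds_theta rds_Phi K_absorbing Phi_compact).
    split=> // z.
    apply: (@measurable_fun_cvg _ _ _ _
      (fun n w => dist_set z (pullback theta Phi K n%:R w))) => [n|w _].
      exact: (measurable_dist_pullback mds_theta rds_Phi).
    exact: (dist_set_pullback_cvg mds_theta rds_Phi K_absorbing Phi_compact).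
  - move=> D DD w; apply: (omega_limit_attracts mds_theta rds_Phi K_absorbing
      Phi_compact _ DD).
    by have [] := DD.
have [[B0 cB _] _] := B_compact.
have A_attr := omega_limit_attracts mds_theta rds_Phi K_absorbing Phi_compact.
apply/funext => w; apply/seteqP; split.
  exact: (invariant_sub_attracting mds_theta A_inv (B0 w) (cB w)
    (B_attr _ AD w)).
exact: (invariant_sub_attracting mds_theta B_inv (A0 w)
  (cA w) (A_attr _ w BD BD.1)).
Qed.
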